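(* Let $G$ be a socle friendly finite group. Let $X$ be a minimal faithful permutation representation of $G$. Then: (1) the number of orbits of $X$ under the action of $G$ is at most $\dim G$; (2) $G$ has perfect minimal faithful permutation representations; and if the center of $G$ has at most one involution, then every minimal faithful permutation representation of $G$ is perfect; (3) if $X_1$, $X_2$ are two perfect minimal faithful permutation representations of $G$, then $m(X_1)=m(X_2)$.
   Context: For a finite group $G$, $\mathcal{M}(G)$ is the set of minimal normal subgroups of $G$, the socle $M(G)$ is the subgroup they generate, and $\mathcal{T}(G)$ is the set of normal subgroups of $G$ contained in $M(G)$. Every $T\in\mathcal{T}(G)$ is an internal direct product of minimal normal subgroups of $G$, and the number of factors depends only on $(G,T)$; it is denoted $\dim_G T$, and $\dim G := \dim_G M(G)$. For a subgroup $H\le G$, $\operatorname{Core}_G(H)=\bigcap_{g\in G} g^{-1}Hg$ and $\operatorname{RC}_G(H)=\operatorname{Core}_G(H)\cap M(G)$. The group $G$ is called socle friendly if $\operatorname{RC}_G(H\cdot T)=\operatorname{RC}_G(H)\cdot T$ for every subgroup $H\le G$ and every $T\in\mathcal{T}(G)$. A minimal faithful permutation representation of $G$ is a finite set $X$ with a faithful $G$-action such that $|X|$ is the smallest possible among all sets on which $G$ acts faithfully (the empty set is allowed when $G$ is trivial). It is called perfect if it has exactly $\dim G$ orbits. For a permutation representation $X$ of $G$, $m(X)$ denotes the multiset of the sizes of the $G$-orbits on $X$. *)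

(* Defs.v *)
From mathcomp Require Import all_boot all_fingroup all_solvable.

Set Implicit Arguments.
Unset Strict Implicit.
Unset Printing Implicit Defensive.

Local Open Scope group_scope.

Section SocleFriendly.

Variable gT : finGroupType.
Implicit Types G H T M : {group gT}.

Definition min_normals G : {set {group gT}} :=
  [set M : {group gT} | (M \subset G) && minnormal M G].

Definition socle G : {set gT} := <<\bigcup_(M in min_normals G) M>>.

Definition socle_normals G : {set {group gT}} :=
  [set T : {group gT} | (T <| G) && (T \subset socle G)].

(* A set P of minimal normal subgroups of G whose internal direct product
   is T; the big dprod evaluates to set0 when the product is not direct. *)
Definition min_normal_decomposition G (A : {set gT}) (P : {set {group gT}}) :=
  (P \subset min_normals G) && (\big[dprod/1]_(M in P) (M : {set gT}) == A).

(* Every element of socle_normals G has such a decomposition, and all its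
   decompositions have the same cardinal; 0 is a junk value for other sets. *)
Definition ndim G (A : {set gT}) : nat :=
  if [pick P | min_normal_decomposition G A P] is Some P then #|P| else 0.

Definition gdim G : nat := ndim G (socle G).

Definition relative_core G (A : {set gT}) : {set gT} := gcore A G :&: socle G.

Definition socle_friendly G : Prop :=
  forall H T, H \subset G -> T \in socle_normals G ->
    relative_core G (H * T) = relative_core G H * T.

End SocleFriendly.

Section PermutationRepresentations.

Variables (gT : finGroupType) (G : {group gT}).

(* X may be empty; it is faithful exactly when G is trivial. *)
Definition min_faithful (X : finType) (to : action G X) : Prop :=
  [faithful G, on [set: X] | to] /\
  forall (Y : finType) (toY : action G Y),
    [faithful G, on [set: Y] | toY] -> #|X| <= #|Y|.

Definition orbits (X : finType) (to : action G X) : {set {set X}} :=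
  orbit to G @: [set: X].

Definition perfect_min_faithful (X : finType) (to : action G X) : Prop :=
  min_faithful to /\ #|orbits to| = gdim G.

(* The multiset of orbit sizes, as a sequence to be compared by perm_eq. *)
Definition orbit_sizes (X : finType) (to : action G X) : seq nat :=
  [seq #|A| | A : {set X} <- enum (orbits to)].

End PermutationRepresentations.

(* Main.v *)
Require Import Defs.
From mathcomp Require Import all_boot all_fingroup all_solvable.
From mathcomp Require Import zify.

(** The normal subgroups of G inside the socle form a complemented modular
    lattice, so minimal normal subgroups satisfy the Steinitz exchange property
    and behave like vectors: independent lists of them have at most gdim G
    members, and spanning lists at least gdim G members.

    A G-set is described by the list of its point stabilizers, one per orbit;
    its degree is the sum of their indices, and it is faithful when every minimal
    normal subgroup escapes some stabilizer. In a minimal list hs no stabilizer H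
    can be dropped, so there is a minimal normal subgroup f H contained in all
    members of hs except H. These dual subgroups are independent, which bounds
    the number of orbits ([min_family_size]).

    When the list is shorter than gdim G, some stabilizer H has a relative core
    of codimension at least 2 in the socle. Socle friendliness then allows H to
    be replaced by HN1 and HN2, for two minimal normal subgroups N1 and N2,
    without losing faithfulness or raising the degree ([min_family_split]).
    Iterating produces a perfect representation. Such a replacement preserves
    the degree only if N1 and N2 have subgroups of index 2; friendliness, applied
    to a twisted copy of N1 in N1 * N2, then shows that N1 and N2 have order 2,
    hence that they contain two distinct central involutions ([gdim_leq_center]).

    Perfect representations are the bases of minimal weight of a matroid, so
    their weights are determined by the greedy exchange argument
    ([min_family_count_leq]): for every t the number of orbits of size below t
    is the same. *)

Set Implicit Arguments.
Unset Strict Implicit.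
Unset Printing Implicit Defensive.

Local Open Scope group_scope.

(** * Independent lists of minimal normal subgroups *)

Section Independence.

Variables (gT : finGroupType) (G : {group gT}).
Implicit Types (A K N : {group gT}) (s Q : seq {group gT}).

Lemma min_normal_norm N : N \in min_normals G -> G \subset 'N(N).
Proof. by rewrite inE => /andP[_ /mingroupp/andP[]]. Qed.

Lemma min_normal_neq1 N : N \in min_normals G -> N :!=: 1.
Proof. by rewrite inE => /andP[_ /mingroupp/andP[]]. Qed.

Lemma min_normal_sub N : N \in min_normals G -> N \subset G.
Proof. by rewrite inE => /andP[]. Qed.

(** The intersection is normalized by G and contained in N, so minimality forces
    it to be trivial or N. *)
Lemma min_normal_TI N K :
    N \in min_normals G -> G \subset 'N(K) -> ~~ (N \subset K) ->
  N :&: K = 1.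
Proof.
move=> minN nKG nsNK; apply: contraNeq nsNK => ntI.
move: (minN); rewrite inE => /andP[_ /mingroupP[_ minN']].
have defI : (N :&: K)%G :=: N.
  apply: minN'; last exact: subsetIl.
  by rewrite ntI normsI // min_normal_norm.
by rewrite -defI subsetIr.
Qed.

(** The Steinitz exchange property. If N' were not in A <*> N, it would meet this
    normalized subgroup trivially, and the modular law would give
    N \subset A * (N' :&: A <*> N) = A. *)
Lemma exchange A N N' :
    G \subset 'N(A) -> N \in min_normals G -> N' \in min_normals G ->
    N \subset A <*> N' -> ~~ (N \subset A) ->
  N' \subset A <*> N.
Proof.
move=> nAG minN minN' sN; apply: contraR => nsN'.
have nN := subset_trans (min_normal_sub minN) nAG.
have nN' := subset_trans (min_normal_sub minN') nAG.
have nY : G \subset 'N((A <*> N)%G) by rewrite normsY // min_normal_norm.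
have TI := min_normal_TI minN' nY nsN'.
rewrite -(mulg1 A) -TI group_modl ?joing_subl //.
by rewrite subsetI joing_subr -norm_joinEr // sN.
Qed.

Definition span s : {group gT} := (\prod_(N <- s) N)%G.

Lemma span_nil : span [::] = 1%G.
Proof. by rewrite /span big_nil. Qed.

Lemma span_cons N s : span (N :: s) = (N <*> span s)%G.
Proof. by rewrite /span big_cons. Qed.

Lemma span_sub s K :
  (span s \subset K) = all (fun N : {group gT} => N \subset K) s.
Proof.
elim: s => [|N s IHs]; first by rewrite span_nil sub1G.
by rewrite span_cons join_subG IHs.
Qed.

Lemma mem_span N s : N \in s -> N \subset span s.
Proof. by move=> Ns; have := subxx (span s); rewrite span_sub => /allP/(_ N Ns). Qed.

Lemma span_norm s : {subset s <= min_normals G} -> G \subset 'N(span s).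
Proof.
elim: s => [|N s IHs] mins; first by rewrite span_nil norms1.
rewrite span_cons normsY //; first by rewrite min_normal_norm ?mins ?mem_head.
apply: IHs => //.
by move=> M Ms; rewrite mins // inE Ms orbT.
Qed.

(** Independence is triangular, each member being tested against the later ones
    only; for minimal normal subgroups this amounts to a direct product. *)
Fixpoint independent s : bool :=
  if s is N :: s' then ~~ (N \subset span s') && independent s' else true.

Lemma independent_uniq s : independent s -> uniq s.
Proof.
elim: s => //= N s IHs /andP[nN /IHs ->]; rewrite andbT.
by apply: contra nN; apply: mem_span.
Qed.

(** R i separates N i from the members that follow it. The subgroups R i need not be normal, so point
    stabilizers can serve as separators. *)
Lemma independent_dual (I : eqType) (N R : I -> {group gT}) (r : seq I) s :
    uniq r -> (forall i, i \in r -> ~~ (N i \subset R i)) ->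
    {in r &, forall i j, i != j -> N j \subset R i} ->
    (forall i, i \in r -> span s \subset R i) -> independent s ->
  independent (map N r ++ s).
Proof.
elim: r => //= i r IHr /andP[nri Ur] nN sN sS inds.
apply/andP; split; last first.
  apply: IHr => // [j rj|j k rj rk|j rj]; rewrite ?nN ?sS ?inE ?rj ?orbT //.
  by apply: sN; rewrite inE ?rj ?rk orbT.
apply: contra (nN i (mem_head _ _)) => sNi; apply: subset_trans sNi _.
have := sS i (mem_head _ _); rewrite !span_sub all_cat => ->.
rewrite andbT all_map.
apply/allP=> j rj /=; apply: sN; rewrite ?mem_head // ?inE ?rj ?orbT //.
by apply: contraNneq nri => ->.
Qed.

(** The first member p of Q for which N enters the span built so far is the one
    that N can replace, by [exchange]. *)
Lemma span_exchange A N Q :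
    G \subset 'N(A) -> N \in min_normals G -> {subset Q <= min_normals G} ->
    N \subset A <*> span Q -> ~~ (N \subset A) ->
  exists2 Q', (size Q').+1 = size Q /\ {subset Q' <= Q}
            & span Q \subset A <*> N <*> span Q'.
Proof.
elim: Q A => [|p Q IHQ] A nAG minN minQ.
  by rewrite span_nil joingG1 => ->.
have minp : p \in min_normals G by rewrite minQ ?mem_head.
have sQ : {subset Q <= min_normals G}.
  by move=> M QM; rewrite minQ // inE QM orbT.
rewrite span_cons /= joingA => sN nsN.
have [sNp | nsNp] := boolP (N \subset A <*> p).
  exists Q; first by split=> // M QM; rewrite inE QM orbT.
  rewrite join_subG joing_subr andbT.
  exact: subset_trans (exchange nAG minN minp sNp nsN) (joing_subl _ _).
have nY : G \subset 'N((A <*> p)%G) by rewrite normsY // min_normal_norm.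
have [Q' [sz sub] sQ'] := IHQ (A <*> p)%G nY minN sQ sN nsNp.
exists (p :: Q').
  split=> [|M]; rewrite /= ?sz // !inE => /predU1P[->|/sub->].
    by rewrite eqxx.
  by rewrite orbT.
rewrite span_cons join_subG /= !joingA; apply/andP; split.
  by rewrite (subset_trans (joing_subr _ _) (joing_subl _ _)).
by apply: subset_trans sQ' _; rewrite /= -(joingA A p N) (joingC p N) joingA.
Qed.

Lemma steinitz s Q :
    {subset s <= min_normals G} -> {subset Q <= min_normals G} ->
    independent s -> span s \subset span Q -> size s <= size Q.
Proof.
move=> mins minQ inds sQ.
suffices [Q' [<- _] _]: exists2 Q', size s + size Q' = size Q
      /\ {subset Q' <= Q} & span Q \subset span s <*> span Q'.
  exact: leq_addr.
elim: s mins inds sQ => [|N s IHs] mins.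
  by move=> _ _; exists Q; [split | exact: joing_subr].
rewrite span_cons join_subG => /= /andP[nsN inds] /andP[sNQ ssQ].
have minN : N \in min_normals G by rewrite mins ?mem_head.
have {}mins : {subset s <= min_normals G}.
  by move=> M sM; rewrite mins // inE sM orbT.
have [Q' [sz sub] sQ'] := IHs mins inds ssQ.
have minQ' : {subset Q' <= min_normals G} by move=> M /sub/minQ.
have [Q2 [sz2 sub2] sQ2] := span_exchange (span_norm mins) minN minQ'
  (subset_trans sNQ sQ') nsN.
exists Q2; first by split=> [|M /sub2/sub//]; rewrite -sz -sz2 addnS.
apply: subset_trans sQ' _; rewrite join_subG /= (joingC N) sQ2 andbT.
by rewrite -joingA joing_subl.
Qed.

Lemma sub_socle N : N \in min_normals G -> N \subset socle G.
Proof. by move=> minN; rewrite sub_gen // (bigcup_sup N). Qed.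

Lemma socle_subP K :
  reflect (forall N, N \in min_normals G -> N \subset K) (socle G \subset K).
Proof. by rewrite gen_subG; apply: bigcupsP. Qed.

(** With [independent_bigdprod]: a family of minimal normal subgroups is
    independent exactly when its internal direct product is defined. *)
Lemma bigdprod_independent s K :
    {subset s <= min_normals G} -> \big[dprod/1]_(N <- s) (N : {set gT}) = K ->
  independent s /\ span s = K.
Proof.
elim: s K => [|N s IHs] K mins.
  by rewrite big_nil span_nil => defK; split=> //; apply: val_inj.
rewrite big_cons => defK; case/dprodP: (defK) => [[_ L _ defL] _ _ _].
have minN : N \in min_normals G by rewrite mins ?mem_head.
have [|inds defs] := IHs L _ defL.
  by move=> M sM; rewrite mins // inE sM orbT.
rewrite defL -defs in defK; case/dprodP: (defK) => _ _ _ TI; split.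
  rewrite /= inds andbT; apply: contra (min_normal_neq1 minN) => sN.
  by rewrite -TI (setIidPl sN).
by apply: val_inj; rewrite span_cons /= (dprodWY defK).
Qed.

Lemma independent_bigdprod s :
    {subset s <= min_normals G} -> independent s ->
  \big[dprod/1]_(N <- s) (N : {set gT}) = span s.
Proof.
elim: s => [|N s IHs] mins /=; first by rewrite big_nil span_nil.
have minN : N \in min_normals G by rewrite mins ?mem_head.
have {}mins : {subset s <= min_normals G}.
  by move=> M sM; rewrite mins // inE sM orbT.
case/andP=> nsN inds; rewrite big_cons IHs // span_cons.
have TI := min_normal_TI minN (span_norm mins) nsN.
have sG : span s \subset G.
  by rewrite span_sub; apply/allP=> M /mins/min_normal_sub.
rewrite dprodEY //; apply/commG1P/trivgP; rewrite -TI subsetI.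
rewrite commg_subl commg_subr (subset_trans sG (min_normal_norm minN)).
by rewrite (subset_trans (min_normal_sub minN) (span_norm mins)).
Qed.

(** A minimal normal subgroup outside the span of an independent list can be put
    in front of it, so the minimal normal subgroups, taken one at a time, yield
    a decomposition of the socle; hence [gdim] is never the default value. *)
Lemma gdim_basis : exists s,
  [/\ {subset s <= min_normals G}, independent s,
      span s = socle G :> {set gT} & size s = gdim G].
Proof.
have basis_of P : min_normal_decomposition G (socle G) P ->
    [/\ {subset enum P <= min_normals G}, independent (enum P)
      & span (enum P) = socle G :> {set gT}].
  case/andP=> /subsetP sP; rewrite -big_enum /= => /eqP defM.
  have minP : {subset enum P <= min_normals G}.
    by move=> N; rewrite mem_enum => /sP.
  have [inds defs] := @bigdprod_independent _ <<_>>%G minP defM.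
  by split=> //; rewrite defs.
rewrite /gdim /ndim; case: pickP => [P /basis_of[sP indP defM] | noP].
  by exists (enum P); rewrite -cardE.
suffices [s [mins inds defM]]: exists s, [/\ {subset s <= min_normals G},
    independent s & span s = socle G :> {set gT}].
  have /idP[] := noP [set N in s]; apply/andP; split.
    by apply/subsetP=> N; rewrite inE => /mins.
  have perm_s : perm_eq (enum [set N in s]) s.
    apply: uniq_perm (enum_uniq _) (independent_uniq inds) _ => N.
    by rewrite mem_enum inE.
  by rewrite -big_enum (perm_big _ perm_s) /= independent_bigdprod ?defM.
have [s [mins inds spans]] : exists s, [/\ {subset s <= min_normals G},
    independent s
  & {in enum (min_normals G), forall N : {group gT}, N \subset span s}].
  have: {subset enum (min_normals G) <= min_normals G}.
    by move=> N; rewrite mem_enum.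
  elim: (enum _) => [|N r IHr] minr; first by exists [::].
  case: IHr => [M rM|s [mins inds spans]]; first by rewrite minr // inE rM orbT.
  have [sN | nsN] := boolP (N \subset span s).
    by exists s; split=> // M; rewrite inE => /predU1P[->|/spans].
  exists (N :: s); split; rewrite /= ?nsN //.
    by move=> M; rewrite inE => /predU1P[->|/mins//]; rewrite minr ?mem_head.
  move=> M; rewrite inE span_cons => /predU1P[->|/spans sM].
    exact: joing_subl.
  exact: subset_trans sM (joing_subr _ _).
exists s; split=> //; apply/eqP; rewrite eqEsubset span_sub.
apply/andP; split; first by apply/allP=> N /mins/sub_socle.
by apply/socle_subP=> N minN; rewrite spans ?mem_enum.
Qed.

Lemma independent_leq_gdim s :
  {subset s <= min_normals G} -> independent s -> size s <= gdim G.
Proof.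
move=> mins inds; have [Q [minQ _ defM <-]] := gdim_basis.
apply: steinitz => //; rewrite span_sub defM.
by apply/allP=> N /mins/sub_socle.
Qed.

Lemma gdim_leq_spanning s :
    {subset s <= min_normals G} ->
    (forall N, N \in min_normals G -> N \subset span s) ->
  gdim G <= size s.
Proof.
move=> mins spans; have [Q [minQ indQ _ <-]] := gdim_basis.
by apply: steinitz => //; rewrite span_sub; apply/allP=> N /minQ/spans.
Qed.

End Independence.

(** * Representations as lists of point stabilizers *)

Section Families.

Variables (gT : finGroupType) (G : {group gT}).
Implicit Types (H K N : {group gT}) (hs : seq {group gT}).

(** The G-set with point stabilizers hs is faithful exactly when its kernel
    contains no minimal normal subgroup N; as N is normal, it lies in the core of
    H as soon as it lies in H, so cores need not be mentioned. *)
Definition faithful_family hs : bool :=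
  all (fun H => H \subset G) hs &&
  [forall (N | N \in min_normals G), has (fun H => ~~ (N \subset H)) hs].

Definition degree hs : nat := \sum_(H <- hs) #|G : H|.

Definition min_family hs : Prop :=
  faithful_family hs /\
  forall hs', faithful_family hs' -> degree hs <= degree hs'.

Lemma faithful_familyP hs :
  reflect ((forall H, H \in hs -> H \subset G) /\
           forall N, N \in min_normals G ->
             exists2 H, H \in hs & ~~ (N \subset H))
          (faithful_family hs).
Proof.
apply: (iffP andP) => [[/allP sG /forall_inP sep] | [sG sep]].
  by split=> // N /sep/hasP.
by split; [apply/allP | apply/forall_inP=> N /sep/hasP].
Qed.

Lemma degree_perm hs hs' : perm_eq hs hs' -> degree hs = degree hs'.
Proof. exact: perm_big. Qed.

Lemma degree_cons H hs : degree (H :: hs) = #|G : H| + degree hs.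
Proof. exact: big_cons. Qed.

Lemma degree_rem H hs : H \in hs -> degree hs = #|G : H| + degree (rem H hs).
Proof. by move/perm_to_rem/degree_perm->; apply: degree_cons. Qed.

(** A dual basis: f H acts trivially on every orbit but that of H. *)
Definition dual_family hs (f : {group gT} -> {group gT}) : Prop :=
  [/\ uniq hs, {in hs, forall H, f H \in min_normals G},
      {in hs, forall H, ~~ (f H \subset H)}
    & {in hs &, forall H K, H != K -> f K \subset H}].

(** Dropping a stabilizer H lowers the degree, so it destroys faithfulness: some
    minimal normal subgroup lies in all the remaining stabilizers, but not in H.
    In particular H does not occur among them, so the list is duplicate-free. *)
Lemma min_family_dual hs : min_family hs -> exists f, dual_family hs f.
Proof.
case=> /faithful_familyP[sG sep] minhs.
have ex_dual H : H \in hs -> exists N, [&& N \in min_normals G,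
    ~~ (N \subset H) & all (fun K => N \subset K) (rem H hs)].
  move=> Hhs; have [faith|] := boolP (faithful_family (rem H hs)).
    have := minhs _ faith; rewrite (degree_rem Hhs) -{2}(add0n (degree _)).
    by rewrite leq_add2r leqNgt indexg_gt0.
  rewrite negb_and; case/orP=> [/negP[]|].
    by apply/allP=> K /mem_rem/sG.
  rewrite negb_forall_in => /existsP[N /andP[minN nsep]].
  have sN : all (fun K => N \subset K) (rem H hs).
    by move: nsep; rewrite -all_predC; apply: sub_all => K; rewrite /= negbK.
  exists N; rewrite minN sN andbT /=; have [K Khs nsK] := sep N minN.
  move: Khs; rewrite (perm_mem (perm_to_rem Hhs)) inE => /predU1P[<- //|].
  by move/(allP sN)=> sNK; rewrite sNK in nsK.
pose f H := odflt H [pick N | [&& N \in min_normals G, ~~ (N \subset H)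
                                & all (fun K => N \subset K) (rem H hs)]].
have fP H : H \in hs -> [/\ f H \in min_normals G, ~~ (f H \subset H)
                          & {in rem H hs, forall K, f H \subset K}].
  move=> Hhs; rewrite /f; case: pickP => [N /and3P[? ? /allP //] | noN].
  by have [N] := ex_dual H Hhs; rewrite noN.
exists f; split=> [|H /fP[]|H /fP[]|H K Hhs Khs neHK] //; last first.
  have [_ _ ->//] := fP K Khs.
  by move: Hhs; rewrite (perm_mem (perm_to_rem Khs)) inE (negPf neHK).
apply: count_mem_uniq => H; have [Hhs|/count_memPn//] := boolP (H \in hs).
rewrite (seq.permP (perm_to_rem Hhs)) /= eqxx (count_memPn _) //.
have [_ nsH sH] := fP H Hhs; apply: contra nsH; exact: sH.
Qed.

Lemma dual_family_independent hs f r s :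
    dual_family hs f -> uniq r -> {subset r <= hs} ->
    (forall H, H \in r -> span s \subset H) -> independent s ->
  independent (map f r ++ s).
Proof.
move=> [_ _ nsf sf] Ur sr ss inds.
apply: (@independent_dual _ _ f id) => // [H /sr/nsf // | H K /sr Hr /sr Kr].
exact: sf.
Qed.

Lemma min_family_size hs : min_family hs -> size hs <= gdim G.
Proof.
case/min_family_dual=> f dualf; have [Uhs minf _ _] := dualf.
rewrite -(size_map f) -[map f hs]cats0; apply: independent_leq_gdim.
  by move=> N; rewrite cats0 => /mapP[H /minf ? ->].
by apply: dual_family_independent dualf _ _ _ _ => // H _; rewrite span_nil sub1G.
Qed.

(** The greedy exchange argument. Suppose that hs has more stabilizers of index
    below t than hs'. The duals of these, followed by the duals of the
    stabilizers of hs' of index at least t, are more than gdim G groups, so they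
    are dependent: some small H of hs does not contain the dual of some large K
    of hs'. Replacing K by H in hs' keeps faithfulness: a minimal normal subgroup
    in the kernel of the new family would extend the duals of hs' to an
    independent list of gdim G + 1 members. This replacement lowers the degree. *)
Lemma min_family_count_leq hs hs' t :
    min_family hs -> min_family hs' ->
    size hs = gdim G -> size hs' = gdim G ->
  count (fun H => #|G : H| < t) hs <= count (fun H => #|G : H| < t) hs'.
Proof.
move=> minhs minhs' sz sz'; rewrite leqNgt; apply/negP=> lt_count.
have [f dualf] := min_family_dual minhs; have [Uhs minf nsf sf] := dualf.
have [f' dualf'] := min_family_dual minhs'; have [Uhs' minf' nsf' sf'] := dualf'.
pose small := [seq H : {group gT} <- hs | #|G : H| < t].
pose large := [seq H : {group gT} <- hs' | ~~ (#|G : H| < t)].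
have [] := boolP (all (fun H => all (fun K => f' K \subset H) large) small).
  move=> /allP sfl.
  suffices: size (map f small ++ (map f' large ++ [::])) <= gdim G.
    rewrite cats0 size_cat !size_map !size_filter leqNgt => /negP[].
    by rewrite -sz' -(count_predC (fun H => #|G : H| < t) hs') ltn_add2r.
  apply: independent_leq_gdim.
    move=> N; rewrite cats0 mem_cat => /orP[] /mapP[H].
      by rewrite mem_filter => /andP[_ /minf ?] ->.
    by rewrite mem_filter => /andP[_ /minf' ?] ->.
  apply: dual_family_independent dualf _ _ _ _ => [||H sH|].
  - exact: filter_uniq.
  - by move=> H; rewrite mem_filter => /andP[].
  - rewrite span_sub cats0 all_map; exact: sfl.
  apply: dual_family_independent dualf' _ _ _ _ => [||H sH|] //.
  - exact: filter_uniq.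
  - by move=> H; rewrite mem_filter => /andP[].
  by rewrite span_nil sub1G.
case/allPn=> H; rewrite mem_filter => /andP[Ht Hhs].
case/allPn=> K; rewrite mem_filter -leqNgt => /andP[Kt Khs'] nsKH.
case: (minhs') => faith' mindeg'; case/faithful_familyP: faith' => sG' sep'.
case: (minhs) => /faithful_familyP[sG _] _.
have: faithful_family (H :: rem K hs').
  apply/faithful_familyP; split=> [L|N minN].
    by rewrite inE => /predU1P[->|/mem_rem]; [apply: sG | apply: sG'].
  apply/hasP; apply: contraT; rewrite -all_predC => /allP sN.
  have {}sN L : L \in H :: rem K hs' -> N \subset L.
    by move/sN; rewrite /= negbK.
  have sNr L : L \in rem K hs' -> (N \subset L) * (f' K \subset L).
    move=> Lr; rewrite sN ?inE ?Lr ?orbT //; split=> //.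
    apply: sf' => //; first exact: mem_rem Lr.
    by apply: contraTneq Lr => ->; rewrite mem_rem_uniqF.
  (* The order matters: f' K and N come last, as every remaining L contains
     both, while N is contained in H and f' K is not. *)
  suffices: size (map f' (rem K hs') ++ [:: f' K; N]) <= gdim G.
    rewrite size_cat size_map size_rem // sz' /= addn2 -sz'.
    by case: (hs') Khs' => //= ? ? _; rewrite ltnn.
  apply: independent_leq_gdim.
    move=> M; rewrite mem_cat => /orP[/mapP[L /mem_rem/minf' ? ->] //|].
    by rewrite mem_seq2 => /pred2P[]-> //; apply: minf'.
  apply: dual_family_independent dualf' _ _ _ _.
  - exact: rem_uniq.
  - by move=> L /mem_rem.
  - by move=> L /sNr[sNL sKL]; rewrite span_sub /= sNL sKL.
  rewrite /= !andbT span_nil subG1 (min_normal_neq1 minN) andbT.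
  rewrite span_cons span_nil /= joingG1; apply: contra nsKH => sKN.
  by rewrite (subset_trans sKN) ?sN ?mem_head.
move/mindeg'; rewrite (degree_rem Khs') degree_cons leq_add2r leqNgt.
by rewrite (leq_trans Ht Kt).
Qed.

Lemma min_family_perm_index hs hs' :
    min_family hs -> min_family hs' ->
    size hs = gdim G -> size hs' = gdim G ->
  perm_eq (map (fun H => #|G : H|) hs) (map (fun H => #|G : H|) hs').
Proof.
move=> minhs minhs' sz sz'.
have eq_lt t :
    count (fun H => #|G : H| < t) hs = count (fun H => #|G : H| < t) hs'.
  by apply/eqP; rewrite eqn_leq !min_family_count_leq.
have count_eq t r :
    count (fun H => #|G : H| < t) r + count (fun H => #|G : H| == t) r
    = count (fun H => #|G : H| < t.+1) r.
  elim: r => //= H r <-; rewrite addnACA ltnS; congr (_ + _).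
  by case: ltngtP.
apply/allP=> t _ /=; rewrite !count_map.
rewrite -(eqn_add2l (count (fun H => #|G : H| < t) hs)).
by rewrite {2}eq_lt !count_eq eq_lt.
Qed.

End Families.

(** * Splitting a point stabilizer in a socle friendly group *)

Lemma add_proper_divisors a1 a2 b1 b2 c :
    0 < a1 -> 0 < a2 -> (a1 * b1 = c)%N -> (a2 * b2 = c)%N -> 1 < b1 -> 1 < b2 ->
  a1 + a2 <= c /\ (c <= a1 + a2 -> b1 = 2 /\ b2 = 2).
Proof.
move=> a1_gt0 a2_gt0 def1 def2 b1_gt1 b2_gt1.
have le1 : (a1 * 2 <= c)%N by rewrite -def1 leq_mul2l b1_gt1 orbT.
have le2 : (a2 * 2 <= c)%N by rewrite -def2 leq_mul2l b2_gt1 orbT.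
split=> [|le_c]; first lia.
have /eqP : (a1 * b1 = a1 * 2)%N by lia.
have /eqP : (a2 * b2 = a2 * 2)%N by lia.
by rewrite !eqn_pmul2l // => /eqP-> /eqP->.
Qed.

Section Splitting.

Variables (gT : finGroupType) (G : {group gT}).
Implicit Types (A H K N : {group gT}) (hs : seq {group gT}).

(** The same set as [relative_core G H], with a group structure. *)
Definition rcore H : {group gT} :=
  (gcore H G :&: <<\bigcup_(M in min_normals G) M>>)%G.

Lemma min_normal_socle_normal N : N \in min_normals G -> N \in socle_normals G.
Proof.
by move=> minN; rewrite inE /normal min_normal_sub ?min_normal_norm ?sub_socle.
Qed.

Lemma socle_norm : G \subset 'N(socle G).
Proof.
apply/subsetP=> x Gx; rewrite inE sub_conjg gen_subG.
apply/bigcupsP=> N minN; rewrite -sub_conjg.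
by rewrite (normsP (min_normal_norm minN)) ?sub_socle.
Qed.

Lemma rcore_norm H : G \subset 'N(rcore H).
Proof. by rewrite normsI ?gcore_norm ?socle_norm. Qed.

Lemma sub_rcore N H : N \in min_normals G -> (N \subset rcore H) = (N \subset H).
Proof.
move=> minN; rewrite subsetI sub_socle // andbT.
by rewrite sub_gcore ?min_normal_norm.
Qed.

Hypothesis friendlyG : socle_friendly G.

(** Where socle friendliness enters: it computes the core of H <*> N. *)
Lemma rcore_mul H N :
  H \subset G -> N \in min_normals G -> rcore (H <*> N) = (rcore H <*> N)%G.
Proof.
move=> sHG minN; apply: val_inj; rewrite /= -/(rcore H).
have nN K : K \subset G -> K \subset 'N(N).
  by move=> sKG; apply: subset_trans sKG (min_normal_norm minN).
have sRG : rcore H \subset G.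
  by apply: subset_trans (subsetIl _ _) (subset_trans (gcore_sub _ _) sHG).
rewrite !norm_joinEl ?nN //.
exact: friendlyG (min_normal_socle_normal minN).
Qed.

(** When rcore H has codimension at least 2 in the socle, two independent
    directions N1 and N2 above it exist, and G / H can be replaced by
    G / HN1 and G / HN2: by friendliness the new relative cores rcore H <*> N1
    and rcore H <*> N2 still intersect in rcore H. Each of the two new orbits has
    at most half the size of the old one, so the degree does not increase, and by
    minimality both indices are exactly 2. *)
Lemma min_family_split hs H N1 N2 :
    min_family G hs -> H \in hs ->
    N1 \in min_normals G -> N2 \in min_normals G ->
    ~~ (N1 \subset H) -> ~~ (N2 \subset rcore H <*> N1) ->
  [/\ min_family G ((H <*> N1)%G :: (H <*> N2)%G :: rem H hs),
      #|H <*> N1 : H| = 2 & #|H <*> N2 : H| = 2].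
Proof.
move=> [faithhs minhs] Hhs minN1 minN2 nsN1 nsN2.
have [sG sep] := faithful_familyP _ _ faithhs.
have sHG := sG H Hhs.
have nsN2H : ~~ (N2 \subset H).
  rewrite -sub_rcore //; apply: contra nsN2 => sN2.
  exact: subset_trans sN2 (joing_subl _ _).
have TI : N1 :&: (rcore H <*> N2) = 1.
  have nY : G \subset 'N(rcore H <*> N2).
    by rewrite normsY ?rcore_norm ?min_normal_norm.
  apply: (min_normal_TI minN1 nY); apply: contra nsN2 => sN1.
  by apply: (exchange (rcore_norm H)) sN1 _; rewrite ?sub_rcore.
set hs2 := (_ :: _ :: _).
have faith2 : faithful_family G hs2.
  apply/faithful_familyP; split=> [K|N minN].
    rewrite !inE => /or3P[/eqP->|/eqP->|/mem_rem/sG //].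
      by rewrite join_subG sHG min_normal_sub.
    by rewrite join_subG sHG min_normal_sub.
  apply/hasP; apply: contraT; rewrite -all_predC => /allP sN.
  have {}sN K : K \in hs2 -> N \subset K by move/sN; rewrite /= negbK.
  have [K] := sep N minN; rewrite (perm_mem (perm_to_rem Hhs)) inE.
  case/predU1P=> [->|Kr]; last by rewrite sN ?inE ?Kr ?orbT.
  have sN1 : N \subset rcore H <*> N1.
    rewrite -[_ <*> _]/(gval (_ <*> _)%G) -rcore_mul // sub_rcore //.
    by rewrite sN ?mem_head.
  have sN2 : N \subset rcore H <*> N2.
    rewrite -[_ <*> _]/(gval (_ <*> _)%G) -rcore_mul // sub_rcore //.
    by rewrite sN ?inE ?eqxx ?orbT.
  rewrite -sub_rcore // -(mulg1 (rcore H)) -TI group_modl ?joing_subl //.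
  have nRN1 : rcore H \subset 'N(N1).
    apply: subset_trans (min_normal_norm minN1).
    by apply: subset_trans (subsetIl _ _) (subset_trans (gcore_sub _ _) sHG).
  by rewrite subsetI -norm_joinEl // sN1 sN2.
have ind N : N \in min_normals G ->
    (#|G : H <*> N| * #|H <*> N : H|)%N = #|G : H|.
  by move=> minN; rewrite Lagrange_index ?joing_subl ?join_subG ?sHG ?min_normal_sub.
have gt1 N : ~~ (N \subset H) -> 1 < #|H <*> N : H|.
  by rewrite indexg_gt1 join_subG subxx.
have [le_deg two] := add_proper_divisors (indexg_gt0 _ _) (indexg_gt0 _ _)
  (ind _ minN1) (ind _ minN2) (gt1 _ nsN1) (gt1 _ nsN2H).
have deg2 : degree G hs2 <= degree G hs.
  by rewrite (degree_rem _ Hhs) !degree_cons addnA leq_add2r.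
have [|eq1 eq2] := two.
  have := minhs _ faith2; rewrite (degree_rem _ Hhs) !degree_cons addnA.
  by rewrite leq_add2r.
by split=> //; split=> // hs' /minhs; apply: leq_trans.
Qed.

(** If no stabilizer can be split, each rcore H is a hyperplane of the socle with
    complement f H. Cutting by one hyperplane after the other and using the
    modular law, the socle is the product of the f H and of the intersection of
    all the rcore H, which is trivial by faithfulness. So the f H span the socle. *)
Lemma gdim_leq_unsplittable hs :
    min_family G hs ->
    (forall H N1 N2, H \in hs -> N1 \in min_normals G -> N2 \in min_normals G ->
       ~~ (N1 \subset H) -> N2 \subset rcore H <*> N1) ->
  gdim G <= size hs.
Proof.
move=> minhs nosplit; have [f [Uhs minf nsf sf]] := min_family_dual minhs.
case: minhs => /faithful_familyP[_ sep] _.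
(* common r is the part of the socle that acts trivially on the orbits of r. *)
pose common r := foldr (fun H K => rcore H :&: K)%G
  <<\bigcup_(M in min_normals G) M>>%G r.
have sub_common r N : N \in min_normals G ->
    (N \subset common r) = all (fun H : {group gT} => N \subset H) r.
  move=> minN; elim: r => [|H r IHr] /=; first exact: sub_socle.
  by rewrite subsetI IHr sub_rcore.
have common_norm r : G \subset 'N(common r).
  by elim: r => [|H r IHr] /=; rewrite ?socle_norm // normsI ?rcore_norm.
have common_socle r : common r \subset socle G.
  by elim: r => //= H r IHr; apply: subset_trans (subsetIr _ _) IHr.
have common1 : common hs :=: 1.
  apply: contraTeq isT => /minnormal_exists/(_ (common_norm hs))[N minN sN].
  have {}minN : N \in min_normals G.
    rewrite inE minN andbT (subset_trans sN) // (subset_trans (common_socle _)) //.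
    by apply/socle_subP=> M /min_normal_sub.
  have [H Hhs /negP[]] := sep N minN.
  by move: sN; rewrite sub_common // => /allP/(_ H Hhs).
have spans r : uniq r -> {subset r <= hs} ->
    socle G \subset common r <*> span (map f r).
  elim: r => [|H r IHr] /= Ur sr; first exact: joing_subl.
  case/andP: Ur => nHr Ur; have Hhs := sr _ (mem_head _ _).
  have {}sr : {subset r <= hs} by move=> K Kr; rewrite sr // inE Kr orbT.
  have sfC : f H \subset common r.
    rewrite sub_common ?minf //; apply/allP=> K Kr.
    apply: sf => //; first exact: sr.
    by apply: contraNneq nHr => <-.
  apply: subset_trans (IHr Ur sr) _; rewrite span_cons /= joingA.
  rewrite join_subG joing_subr andbT; apply: subset_trans (joing_subl _ _).
  have sM : socle G \subset f H * rcore H.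
    rewrite -norm_joinEr; last first.
      rewrite (subset_trans _ (min_normal_norm (minf H Hhs))) //.
      rewrite (subset_trans (subsetIr _ _)) //.
      by apply/socle_subP=> M /min_normal_sub.
    apply/(@socle_subP _ _ (f H <*> rcore H)%G) => N minN /=.
    by rewrite joingC nosplit ?minf ?nsf.
  rewrite joingC (subset_trans _ (mul_subG (joing_subl _ _) (joing_subr _ _))) //.
  by rewrite group_modl // subsetI subxx (subset_trans (common_socle _)).
rewrite -(size_map f); apply: gdim_leq_spanning.
  by move=> N /mapP[H /minf ? ->].
move=> N minN; apply: subset_trans (sub_socle minN) _.
by have := spans hs Uhs (fun H => id); rewrite common1 joing1G.
Qed.

(** Membership outside a subgroup of index 2 is a morphism to Z/2. *)
Lemma index2_notinM A N x y :
    A \subset N -> #|N : A| = 2 -> x \in N -> y \in N ->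
  (x * y \notin A) = (x \notin A) (+) (y \notin A).
Proof.
move=> sAN indA Nx Ny; case: (boolP (x \in A)) => [Ax | nAx].
  by rewrite groupMl.
case: (boolP (y \in A)) => [Ay | nAy]; first by rewrite groupMr // nAx.
have defAx: A :* x = N :\: A by apply: rcoset_index2; rewrite // inE nAx.
have: x \in A :* y^-1.
  by rewrite (rcoset_index2 sAN indA) ?inE ?groupV ?nAy // nAx.
by rewrite mem_rcoset invgK => ->.
Qed.

(** Twisting N1 by the morphism onto <[z]> with kernel A gives a subgroup D, the
    graph {x * z ^+ (x \notin A) | x \in N1}, with N1 \subset D <*> N2.
    Friendliness then forces N1 \subset rcore D <*> N2. As rcore D meets N1
    inside A, hence trivially, and D meets N2 trivially, an element of A, which
    lies in D, splits with trivial N2 part, so it lies in N1 :&: rcore D = 1. *)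
Lemma friendly_index2 N1 N2 A z :
    N1 \in min_normals G -> N2 \in min_normals G -> N1 :&: N2 = 1 ->
    A \subset N1 -> #|N1 : A| = 2 -> z \in N2 -> #[z] = 2 ->
  A :=: 1.
Proof.
move=> minN1 minN2 TI sAN1 indA N2z oz.
have cN12 : N2 \subset 'C(N1).
  apply/commG1P/trivgP; rewrite -TI [N1 :&: N2]setIC subsetI.
  have nN N N' : N \in min_normals G -> N' \in min_normals G -> N \subset 'N(N').
    by move=> minN /min_normal_norm; apply: subset_trans (min_normal_sub minN).
  by rewrite commg_subl commg_subr !nN.
have cz x n : x \in N1 -> commute (z ^+ n) x.
  by move=> N1x; apply: (centsP cN12); rewrite ?groupX.
pose g x := x * z ^+ (x \notin A).
have gM : {in N1 &, {morph g : x y / x * y}}.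
  move=> x y N1x N1y; rewrite /g (index2_notinM sAN1 indA) //.
  rewrite -!mulgA [in RHS](mulgA _ y) cz // -!mulgA -expgD; congr (_ * (_ * _)).
  have z2 : z ^+ 2 = 1 by rewrite -oz expg_order.
  by case: (x \in A); case: (y \in A) => //=; apply: esym z2.
have D_group : group_set (g @: N1).
  apply/group_setP; split.
    by apply/imsetP; exists 1; rewrite // /g group1 mulg1.
  move=> _ _ /imsetP[x N1x ->] /imsetP[y N1y ->].
  by rewrite -gM // imset_f ?groupM.
pose D := Group D_group.
have sgN x : g x * z ^- (x \notin A) = x by rewrite /g mulgK.
have sDG : D \subset G.
  apply/subsetP=> _ /imsetP[x N1x ->]; rewrite groupM ?groupX //.
    exact: subsetP (min_normal_sub minN1) _ _.
  exact: subsetP (min_normal_sub minN2) _ _.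
have DN2 y : y \in D -> y \in N2 -> y = 1.
  case/imsetP=> x N1x ->; rewrite /g groupMr ?groupX // => N2x.
  have: x \in N1 :&: N2 by rewrite inE N1x.
  by rewrite TI => /set1P->; rewrite group1 mulg1.
have DN1 y : y \in D -> y \in N1 -> y \in A.
  case/imsetP=> x N1x ->; rewrite /g; case: (boolP (x \in A)) => [Ax|_].
    by rewrite mulg1.
  rewrite groupMl // => N1z; have: z \in N1 :&: N2 by rewrite inE N1z.
  by rewrite TI => /set1P z1; rewrite z1 order1 in oz.
have sAD : A \subset D.
  apply/subsetP=> x Ax; apply/imsetP; exists x; first exact: (subsetP sAN1).
  by rewrite /g Ax mulg1.
have sN1 : N1 \subset rcore D <*> N2.
  rewrite -[_ <*> _]/(gval (_ <*> _)%G) -rcore_mul // sub_rcore //.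
  apply/subsetP=> x N1x; rewrite -(sgN x) groupM ?groupV ?groupX //.
    by apply: subsetP (joing_subl _ _) _ _; apply: imset_f.
  exact: subsetP (joing_subr _ _) _ N2z.
have TI1 : N1 :&: rcore D = 1.
  apply: (min_normal_TI minN1 (rcore_norm D)).
  rewrite sub_rcore //; apply/negP=> sN1D.
  have /negP[] : ~~ (N1 \subset A) by rewrite -indexg_gt1 indA.
  by apply/subsetP=> x N1x; apply: DN1 => //; apply: (subsetP sN1D).
apply/trivgP/subsetP=> x Ax; have N1x := subsetP sAN1 x Ax.
have nN2 : rcore D \subset 'N(N2).
  apply: subset_trans (min_normal_norm minN2).
  by apply: subset_trans (subsetIl _ _) (subset_trans (gcore_sub _ _) sDG).
have := subsetP sN1 x N1x; rewrite norm_joinEl // => /mulsgP[k n Rk N2n defx].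
have Dk : k \in D.
  by apply: subsetP Rk; rewrite (subset_trans (subsetIl _ _)) ?gcore_sub.
have n1 : n = 1.
  apply: DN2 => //; rewrite -(groupMl _ Dk) -defx; exact: (subsetP sAD).
by rewrite -TI1 inE N1x defx n1 mulg1.
Qed.

Lemma normal_order2_central N z :
  N \in min_normals G -> #|N| = 2 -> z \in N -> z != 1 -> z \in 'Z(G).
Proof.
move=> minN oN Nz ntz; have Gz := subsetP (min_normal_sub minN) z Nz.
rewrite inE Gz; apply/centP=> x Gx; apply/commgP/conjg_fixP.
have Nzx : z ^ x \in N by rewrite memJ_norm ?(subsetP (min_normal_norm minN)).
have defN : N :=: [set 1; z].
  apply/esym/eqP; rewrite eqEcard subUset !sub1set group1 Nz cards2 oN.
  by rewrite eq_sym ntz.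
move: Nzx; rewrite defN !inE -(conj1g x) (can_eq (conjgK _)) (negPf ntz).
by move/eqP.
Qed.

(** A split is impossible here: it would give N1 and N2 with subgroups of index 2,
    so both would have order 2 by [friendly_index2], hence provide two distinct
    central involutions. *)
Lemma gdim_leq_center hs :
    #|[set z in 'Z(G) | #[z] == 2]| <= 1 -> min_family G hs ->
  gdim G <= size hs.
Proof.
move=> Z1 minhs; apply: gdim_leq_unsplittable => // H N1 N2 Hhs minN1 minN2 nsN1.
apply: contraT => nsN2.
have [_ ind1 ind2] := min_family_split minhs Hhs minN1 minN2 nsN1 nsN2.
have TI : N1 :&: N2 = 1.
  rewrite setIC; apply: (min_normal_TI minN2 (min_normal_norm minN1)).
  by apply: contra nsN2 => sN21; apply: subset_trans sN21 (joing_subr _ _).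
have sHG : H \subset G by case: minhs => /faithful_familyP[sG _] _; apply: sG.
have index_cap N : N \in min_normals G -> #|H <*> N : H| = 2 ->
    #|N : N :&: H| = 2.
  move=> minN; rewrite norm_joinEl ?(subset_trans sHG) ?min_normal_norm //.
  by rewrite indexgI indexMg.
have invol N : #|N : N :&: H| = 2 -> exists2 z, z \in N & #[z] = 2.
  move=> indN; have [//||z Nz oz] := @Cauchy _ 2 N; last by exists z.
  by rewrite -indN dvdn_indexg.
have [z1 Nz1 oz1] := invol N1 (index_cap _ minN1 ind1).
have [z2 Nz2 oz2] := invol N2 (index_cap _ minN2 ind2).
have central N N' z z' : N \in min_normals G -> N' \in min_normals G ->
    N :&: N' = 1 -> #|N : N :&: H| = 2 -> z \in N -> #[z] = 2 ->
    z' \in N' -> #[z'] = 2 -> z \in [set z in 'Z(G) | #[z] == 2].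
  move=> minN minN' TIN indN Nz oz Nz' oz'; rewrite inE oz eqxx andbT.
  have A1 := friendly_index2 minN minN' TIN (subsetIl _ _) indN Nz' oz'.
  apply: (normal_order2_central minN) => //; last by rewrite -order_gt1 oz.
  by rewrite -indN A1 indexg1.
have Z_z1 := central _ _ _ _ minN1 minN2 TI (index_cap _ minN1 ind1) Nz1 oz1 Nz2 oz2.
have Z_z2 : z2 \in [set z in 'Z(G) | #[z] == 2].
  have TI21 : N2 :&: N1 = 1 by rewrite setIC.
  exact: central minN2 minN1 TI21 (index_cap _ minN2 ind2) Nz2 oz2 Nz1 oz1.
have eqz : z1 = z2 by apply: (card_le1_eqP Z1).
have: z1 \in N1 :&: N2 by rewrite inE Nz1 eqz.
by rewrite TI => /set1P z11; rewrite z11 order1 in oz1.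
Qed.

End Splitting.

(** * From actions to lists of point stabilizers and back *)

Section Representations.

Variables (gT : finGroupType) (G : {group gT}).
Implicit Types (H N : {group gT}) (hs : seq {group gT}).

(** The kernel is normal, so if nontrivial it contains a minimal normal subgroup. *)
Lemma astab_min_normal (X : finType) (to : action G X) :
    (forall N, N \in min_normals G -> ~~ (N \subset 'C([set: X] | to))) <->
  [faithful G, on [set: X] | to].
Proof.
split=> [noN | faith N minN].
  have nK : G \subset 'N('C_G([set: X] | to)).
    rewrite normsI ?normG //; apply: subset_trans (astab_norm to _).
    apply/subsetP=> a Ga.
    by rewrite !inE Ga; apply/subsetP=> x; rewrite !inE.
  apply: contraT; rewrite /faithful => ntK.
  have [] := @minnormal_exists _ G 'C_G([set: X] | to)%G _ nK.
    by apply: contra ntK => /eqP /= ->.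
  move=> N minN sN; have sNG := subset_trans sN (subsetIl _ _).
  have /noN/negP[] : N \in min_normals G by rewrite inE sNG.
  exact: subset_trans sN (subsetIr _ _).
apply: contra (min_normal_neq1 minN) => sN; rewrite -subG1.
apply: subset_trans faith; rewrite subsetI sN.
by rewrite (min_normal_sub minN).
Qed.

Lemma rep_family (X : finType) (to : action G X) : exists hs,
  [/\ orbit_sizes to = [seq #|G : gval H| | H <- hs],
      #|X| = degree G hs
    & faithful_family G hs <-> [faithful G, on [set: X] | to]].
Proof.
pose stab (A : {set X}) : {group gT} :=
  if [pick x in A] is Some x then 'C_G[x | to]%G else G.
have stabP A : A \in orbits to ->
    exists2 x, A = orbit to G x & stab A = 'C_G[x | to]%G.
  case/imsetP=> x _ ->; rewrite /stab; case: pickP => [y xGy | /(_ x)].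
    by exists y => //; apply/esym/orbit_in_eqP.
  by rewrite orbit_refl.
have card_stab A : A \in orbits to -> #|A| = #|G : stab A|.
  by case/stabP=> x -> ->; rewrite card_orbit_in.
exists (map stab (enum (orbits to))); split.
- rewrite /orbit_sizes -map_comp; apply/eq_in_map=> A.
  by rewrite mem_enum => /card_stab.
- rewrite /degree big_map big_enum /= -(eq_bigr _ card_stab).
  rewrite acts_sum_card_orbit ?cardsT //.
  by apply/subsetP=> a Ga; rewrite !inE Ga; apply/subsetP=> x; rewrite !inE.
apply: iff_trans (astab_min_normal to); split.
  case/faithful_familyP=> _ sep N minN; have [H] := sep N minN; case/mapP=> A.
  rewrite mem_enum => /stabP[x _ ->] -> nsN.
  apply: contra nsN => sN; rewrite subsetI /= (min_normal_sub minN).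
  exact: subset_trans sN (astabS _ (subsetT _)).
move=> noN; apply/faithful_familyP; split=> [H /mapP[A]|N minN].
  by rewrite mem_enum => /stabP[x _ ->] ->; apply: subsetIl.
apply/hasP; apply: contraR (noN N minN); rewrite -all_predC => /allP sN.
apply/subsetP=> a Na; have sNG := subsetP (min_normal_sub minN).
rewrite inE (sNG a Na); rewrite inE; apply/subsetP=> y _; rewrite inE.
have orb_y : orbit to G y \in orbits to by apply: imset_f.
have [x xy stab_y] := stabP _ orb_y.
have /sN : stab (orbit to G y) \in map stab (enum (orbits to)).
  by apply: map_f; rewrite mem_enum.
rewrite /= negbK stab_y => /subsetP sNx.
have /orbitP[g Gg defy] : y \in orbit to G x by rewrite -xy orbit_refl.
have Nag : a ^ g^-1 \in N.
  by rewrite memJ_norm // (subsetP (min_normal_norm minN)) ?groupV.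
have /setIP[_ /astab_act/(_ (set11 x)) fix_x] := sNx _ Nag.
(* N is normal, so moving the base point x to y = x g only conjugates it. *)
have -> : to y a = to (to x (a ^ g^-1)) g.
  rewrite -defy -(actMin to x Gg (sNG a Na)) -(actMin to x (sNG _ Nag) Gg).
  by rewrite conjgE invgK -!mulgA mulVg mulg1.
by rewrite fix_x defy.
Qed.

(** The G-set is the disjoint union of the coset spaces G / H for H in hs, the
    position in hs being recorded so that repeated stabilizers count separately.
    The cosets H themselves lie in different orbits, which is all that the count
    of orbits requires. *)
Lemma family_rep hs : {in hs, forall H, H \subset G} ->
  exists (X : finType) (to : action G X),
  [/\ #|X| = degree G hs,
      faithful_family G hs -> [faithful G, on [set: X] | to]
    & size hs <= #|orbits to|].
Proof.
move=> sG; pose h (i : 'I_(size hs)) : {group gT} := nth G hs i.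
have shG i : h i \subset G by apply/sG/mem_nth.
pose T := ('I_(size hs) * {set gT})%type.
pose f (p : T) (a : gT) : T := (p.1, p.2 :* a).
have f1 p : f p 1 = p by case: p => i A; rewrite /f /= rcoset1.
have fM p a b : f p (a * b) = f (f p a) b by rewrite /f /= rcosetM.
pose fact := TotalAction f1 fM.
pose P (p : T) := p.2 \in rcosets (h p.1) G.
have fP p a : a \in G -> P (f p a) = P p.
  move=> Ga; rewrite /P /f /=; apply/rcosetsP/rcosetsP=> [] [x Gx defA].
    exists (x * a^-1); rewrite ?groupM ?groupV //.
    by rewrite rcosetM -defA -rcosetM mulgV rcoset1.
  by exists (x * a); rewrite ?groupM // defA rcosetM.
pose X := {p : T | P p}.
have sGdom : G \subset subact_dom P fact.
  apply/subsetP=> a Ga; rewrite !inE /=; apply/subsetP=> p; rewrite !inE /=.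
  by move=> Pp; have := fP p a Ga; rewrite Pp.
pose to : action G X := (@subaction _ _ _ P X fact \ sGdom)%act.
have val_to x a : a \in G -> val (to x a) = f (val x) a.
  by move=> Ga; rewrite /to /= /ract val_subact (subsetP sGdom).
exists X, to; split.
- rewrite card_sig -sum1_card /degree (big_nth G) big_mkord.
  under [RHS]eq_bigr => i _ do rewrite -[#|_ : _|]sum1_card.
  by rewrite pair_big_dep; apply: eq_bigl => p.
- case/faithful_familyP=> _ sep; apply/astab_min_normal => N minN.
  have [H Hhs nsN] := sep N minN; apply: contra nsN => sN.
  have lt_i : index H hs < size hs by rewrite index_mem.
  pose i := Ordinal lt_i; have hi : h i = H by apply: nth_index.
  have Pi : P (i, h i : {set gT}) by apply/rcosetsP; exists 1; rewrite ?rcoset1.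
  apply/subsetP=> a Na; have Ga := subsetP (min_normal_sub minN) a Na.
  have := astab_act (subsetP sN a Na) (in_setT (Sub _ Pi : X)).
  move/(congr1 val); rewrite val_to //= => -[defH].
  by have := rcoset_refl (h i) a; rewrite defH hi.
have Pi i : P (i, h i : {set gT}) by apply/rcosetsP; exists 1; rewrite ?rcoset1.
pose base i : X := Sub _ (Pi i).
have inj_orb : injective (fun i => orbit to G (base i)).
  move=> i j /= eq_orb; have := orbit_refl to G (base i).
  rewrite eq_orb => /orbitP[a Ga /(congr1 val)].
  by rewrite val_to //= => -[].
have card_orb := card_imset predT inj_orb; rewrite card_ord in card_orb.
apply: leq_trans (eq_leq (esym card_orb)) _.
by apply/subset_leq_card/subsetP=> _ /imsetP[i _ ->]; apply: imset_f.
Qed.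

Hypothesis friendlyG : socle_friendly G.

Lemma min_rep_family (X : finType) (to : action G X) :
    min_faithful to -> exists2 hs,
      orbit_sizes to = [seq #|G : gval H| | H <- hs] & min_family G hs.
Proof.
case=> faith minX; have [hs [szs cardX /proj2/(_ faith) faithhs]] := rep_family to.
exists hs => //; split=> // hs' faith'; rewrite -cardX.
have [sG _] := faithful_familyP _ _ faith'.
by have [Y [toY [<- /(_ faith')/minX]]] := family_rep sG.
Qed.

Lemma size_orbit_sizes (X : finType) (to : action G X) :
  size (orbit_sizes to) = #|orbits to|.
Proof. by rewrite size_map -cardE. Qed.

Lemma min_rep_orbits_leq (X : finType) (to : action G X) :
  min_faithful to -> #|orbits to| <= gdim G.
Proof.
case/min_rep_family=> hs szs minhs.
by rewrite -size_orbit_sizes szs size_map min_family_size.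
Qed.

Lemma degree_undup hs : degree G (undup hs) <= degree G hs.
Proof.
elim: hs => //= H hs IHhs; rewrite degree_cons; case: ifP => _.
  exact: leq_trans IHhs (leq_addl _ _).
by rewrite degree_cons leq_add2l.
Qed.

Lemma faithful_family_eq_mem hs hs' :
  hs =i hs' -> faithful_family G hs = faithful_family G hs'.
Proof.
move=> eqhs; rewrite /faithful_family (eq_all_r eqhs); congr (_ && _).
by apply: eq_forallb => N; rewrite (eq_has_r eqhs).
Qed.

(** Repeated stabilizers only increase the degree, so it is enough to minimize
    over the finitely many sets of subgroups. *)
Lemma min_family_exists : exists hs, min_family G hs.
Proof.
have faith1 : faithful_family G (enum [set 1%G]).
  apply/faithful_familyP; split=> [H|N minN].
    by rewrite mem_enum inE => /eqP->; apply: sub1G.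
  by exists 1%G; rewrite ?mem_enum ?inE // subG1 (min_normal_neq1 minN).
have [P] := @arg_minnP _ [set 1%G]
  (fun P : {set {group gT}} => faithful_family G (enum P))
  (fun P : {set {group gT}} => degree G (enum P)) faith1.
move=> faithP minP; exists (enum P); split=> // hs faith.
have perm_hs : perm_eq (enum [set H in hs]) (undup hs).
  apply: uniq_perm (enum_uniq _) (undup_uniq _) _ => H.
  by rewrite mem_enum inE mem_undup.
apply: leq_trans (degree_undup hs); rewrite -(degree_perm _ perm_hs).
apply: minP; rewrite -(faithful_family_eq_mem (hs := hs)) // => H.
by rewrite mem_enum inE.
Qed.

(** Splitting lengthens the list by one and preserves minimality, and the length
    is bounded by gdim G: iterate until no stabilizer can be split. *)
Lemma perfect_family_exists :
  exists2 hs, min_family G hs & size hs = gdim G.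
Proof.
have [hs minhs] := min_family_exists.
have [k] := ubnP (gdim G - size hs); elim: k hs minhs => // k IHk hs minhs le_k.
have [le_sz | lt_sz] := leqP (gdim G) (size hs).
  by exists hs => //; apply/eqP; rewrite eqn_leq le_sz min_family_size.
pose splits (p : {group gT} * {group gT} * {group gT}) :=
  let: (H, N1, N2) := p in [&& H \in hs, N1 \in min_normals G,
    N2 \in min_normals G, ~~ (N1 \subset H) & ~~ (N2 \subset rcore G H <*> N1)].
have [[[H N1] N2] /and5P[Hhs minN1 minN2 nsN1 nsN2]|nosplit] := pickP splits.
  have [minhs2 _ _] := min_family_split friendlyG minhs Hhs minN1 minN2 nsN1 nsN2.
  apply: IHk minhs2 _; rewrite /= size_rem // prednK; last by case: (hs) Hhs.
  by rewrite -ltnS (leq_trans _ le_k) // ltnS subnS prednK ?subn_gt0.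
suffices: gdim G <= size hs by rewrite leqNgt lt_sz.
apply: (gdim_leq_unsplittable minhs) => H N1 N2 Hhs minN1 minN2 nsN1.
by have := nosplit (H, N1, N2); rewrite /= Hhs minN1 minN2 nsN1 /= => /negbFE.
Qed.

Lemma perfect_rep_exists :
  exists (X : finType) (to : action G X), perfect_min_faithful to.
Proof.
have [hs minhs szhs] := perfect_family_exists.
case: (minhs) => faith min_deg; have [sG _] := faithful_familyP _ _ faith.
have [X [to [cardX /(_ faith) faithX le_orb]]] := family_rep sG.
have min_to : min_faithful to.
  split=> // Y toY faithY.
  have [hs' [_ -> /proj2/(_ faithY)/min_deg]] := rep_family toY.
  by rewrite cardX.
exists X, to; split=> //; apply/eqP.
by rewrite eqn_leq min_rep_orbits_leq // -szhs.
Qed.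

End Representations.

Theorem theorem3p18 (gT : finGroupType) (G : {group gT})
    (friendlyG : socle_friendly G) :
  [/\ forall (X : finType) (to : action G X),
        min_faithful to -> #|orbits to| <= gdim G,
      (exists (X : finType) (to : action G X), perfect_min_faithful to) /\
      (#|[set z in 'Z(G) | #[z] == 2]| <= 1 ->
        forall (X : finType) (to : action G X),
          min_faithful to -> perfect_min_faithful to)
    & forall (X1 X2 : finType) (to1 : action G X1) (to2 : action G X2),
        perfect_min_faithful to1 -> perfect_min_faithful to2 ->
        perm_eq (orbit_sizes to1) (orbit_sizes to2)].
Proof.
split=> [X to||X1 X2 to1 to2].
- exact: min_rep_orbits_leq.
- split=> [|Z1 X to min_to]; first exact: perfect_rep_exists.
  split=> //; apply/eqP; rewrite eqn_leq min_rep_orbits_leq //=.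
  have [hs szs minhs] := min_rep_family min_to.
  rewrite -size_orbit_sizes szs size_map.
  exact: gdim_leq_center.
case=> min1 sz1 [min2 sz2].
have [hs1 szs1 minhs1] := min_rep_family min1.
have [hs2 szs2 minhs2] := min_rep_family min2.
rewrite szs1 szs2; apply: min_family_perm_index => //.
  by rewrite -sz1 -size_orbit_sizes szs1 size_map.
by rewrite -sz2 -size_orbit_sizes szs2 size_map.
Qed.
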